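(* Let $k\ge 1$ be a fixed integer and suppose $p=p(n)$ satisfies $p^{k+1}n\to 0$ and $p^k n\to\infty$ as $n\to\infty$. Then almost always $X(n,p)$ retracts onto a subcomplex homeomorphic to the sphere $\mathbb{S}^k$. Hence almost always $\widetilde{H}_k(X(n,p),\mathbb{Z})$ has a $\mathbb{Z}$ summand.
   Context: $G(n,p)$ is the random graph on vertex set $[n]$ with each edge included independently with probability $p$. The clique complex $X(H)$ of a graph $H$ is the simplicial complex whose faces are the vertex sets of complete subgraphs of $H$; $X(n,p)$ denotes $X(G(n,p))$. $\widetilde H_k$ denotes reduced homology. ''Almost always'' means with probability tending to $1$ as $n\to\infty$. *)

(* Defs.v *)
From HB Require Import structures.
From mathcomp Require Import all_boot all_order all_algebra.
From mathcomp Require Import all_classical all_reals all_analysis.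

Set Implicit Arguments.
Unset Strict Implicit.
Unset Printing Implicit Defensive.

Import Order.TTheory GRing.Theory Num.Theory.
Import numFieldNormedType.Exports.

Local Open Scope ring_scope.

(* Faces are finite sets of vertices.  The empty face is always present (it is
   what makes the homology below reduced), and not every [[set i]] has to be a
   face, so that a subcomplex may have fewer vertices. *)
Record simplicial_complex (n : nat) := Complex {
  faces : {set {set 'I_n}};
  faces0 : finset.set0 \in faces;
  faces_sub : forall s t : {set 'I_n}, t \subset s -> s \in faces -> t \in faces
}.

Definition subcomplex n (Y X : simplicial_complex n) : bool :=
  faces Y \subset faces X.

(* Chains are graded by the cardinality of the faces: [chain X k.+1] is the
   group of k-chains, and [chain X 0], spanned by the empty face, is the target
   of the augmentation. *)
Notation face X m := {s | (s \in faces X) && (#|s| == m%N)}.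
Notation chain X m := {ffun face X m -> int}.

(* Faces are oriented by the order of ['I_n]: [incidence s t] is (-1)^i when t
   is s without its i-th smallest vertex (counting from 0), and 0 when t is not
   of the form [s :\ v] with v in s. *)
Definition incidence n (s t : {set 'I_n}) : int :=
  \sum_(v in s | t == (s :\ v)%SET) (-1) ^+ #|[set u in s | (u < v)%N]%SET|.

Definition boundary n (X : simplicial_complex n) m (c : chain X m.+1) : chain X m :=
  [ffun t => \sum_(s : face X m.+1) incidence (val s) (val t) * c s].

Lemma boundary_is_zmod_morphism n (X : simplicial_complex n) m :
  zmod_morphism (@boundary n X m).
Proof.
move=> c d; apply/ffunP => t; rewrite !ffunE -sumrB.
by apply: eq_bigr => s _; rewrite !ffunE mulrBr.
Qed.

HB.instance Definition _ n (X : simplicial_complex n) m :=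
  GRing.isZmodMorphism.Build (chain X m.+1) (chain X m) (@boundary n X m)
    (@boundary_is_zmod_morphism n X m).

Definition is_cycle n (X : simplicial_complex n) k : {pred chain X k.+1} :=
  [pred c | boundary c == 0].

Lemma is_cycle_zmod_closed n (X : simplicial_complex n) k : zmod_closed (@is_cycle n X k).
Proof.
split=> [|c d]; rewrite !inE ?raddf0 //.
by move=> /eqP c0 /eqP d0; rewrite raddfB /= c0 d0 subr0.
Qed.

HB.instance Definition _ n (X : simplicial_complex n) k :=
  GRing.isZmodClosed.Build (chain X k.+1) (@is_cycle n X k)
    (@is_cycle_zmod_closed n X k).

Record cycles n (X : simplicial_complex n) k := Cycle {
  cycle_val :> chain X k.+1;
  _ : cycle_val \in @is_cycle n X k
}.
HB.instance Definition _ n (X : simplicial_complex n) k :=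
  [isSub for @cycle_val n X k].
HB.instance Definition _ n (X : simplicial_complex n) k :=
  [Choice of cycles X k by <:].
HB.instance Definition _ n (X : simplicial_complex n) k :=
  [SubChoice_isSubZmodule of cycles X k by <:].

Definition is_boundary n (X : simplicial_complex n) k : {pred cycles X k} :=
  [pred z | `[< exists b : chain X k.+2, boundary b = val z >]].

Lemma is_boundary_zmod_closed n (X : simplicial_complex n) k :
  zmod_closed (@is_boundary n X k).
Proof.
split=> [|x y]; rewrite -!topredE /=.
  by apply/asboolP; exists 0; rewrite !raddf0.
move=> /asboolP[b bx] /asboolP[c cy]; apply/asboolP.
by exists (b - c); rewrite !raddfB /= bx cy.
Qed.

HB.instance Definition _ n (X : simplicial_complex n) k :=
  GRing.isZmodClosed.Build (cycles X k) (@is_boundary n X k)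
    (@is_boundary_zmod_closed n X k).

Definition reduced_homology n (X : simplicial_complex n) (k : nat) : zmodType :=
  {ideal_quot (@is_boundary n X k)}.

Definition has_Z_summand (H : zmodType) : Prop :=
  exists (A : zmodType) (f : {additive (int * A)%type -> H}), bijective f.

Local Open Scope classical_set_scope.

Definition realization (R : realType) n (X : simplicial_complex n) :
    set 'rV[R]_n :=
  [set x : 'rV[R]_n |
    [/\ forall i, 0 <= x ord0 i, \sum_i x ord0 i = 1
      & finset (fun i => x ord0 i != 0) \in faces X]].
Arguments realization R {n} X.

Definition sphere (R : realType) (k : nat) : set 'rV[R]_k.+1 :=
  [set x : 'rV[R]_k.+1 | \sum_i x ord0 i ^+ 2 = 1].
Arguments sphere R k : clear implicits.

Definition retracts_onto (T : topologicalType) (A B : set T) : Prop :=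
  B `<=` A /\
  exists r : T -> T, [/\ {within A, continuous r}, set_fun A B r
                       & forall x, B x -> r x = x].

Definition homeomorphic (T U : topologicalType) (A : set T) (B : set U) : Prop :=
  exists (f : T -> U) (g : U -> T),
    [/\ {within A, continuous f}, {within B, continuous g},
        set_fun A B f, set_fun B A g
      & (forall x, A x -> g (f x) = x) /\ (forall y, B y -> f (g y) = y)].

Definition retracts_onto_sphere (R : realType) n (X : simplicial_complex n)
    (k : nat) : Prop :=
  exists Y : simplicial_complex n,
    [/\ subcomplex Y X, retracts_onto (realization R X) (realization R Y)
      & homeomorphic (realization R Y) (sphere R k)].

(* A simple graph on ['I_n] is given by its set of edges, an edge being a pair
   of distinct vertices. *)
Notation edge n := {e : {set 'I_n} | #|e| == 2%N}.
Notation graph n := {set edge n}.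

Definition clique n (G : graph n) (s : {set 'I_n}) : bool :=
  [forall e : edge n, (val e \subset s) ==> (e \in G)].

Definition clique_faces n (G : graph n) : {set {set 'I_n}} :=
  finset (clique G).

Lemma clique_faces0 n (G : graph n) : finset.set0 \in clique_faces G.
Proof.
rewrite inE; apply/forallP => e; apply/implyP; rewrite finset.subset0 => /eqP e0.
by have := valP e; rewrite /= e0 cards0.
Qed.

Lemma clique_faces_sub n (G : graph n) (s t : {set 'I_n}) :
  t \subset s -> s \in clique_faces G -> t \in clique_faces G.
Proof.
rewrite !inE => ts /forallP Gs; apply/forallP => e; apply/implyP => et.
by have /implyP := Gs e; apply; exact: fintype.subset_trans et ts.
Qed.

Definition clique_complex n (G : graph n) : simplicial_complex n :=
  Complex (clique_faces0 G) (@clique_faces_sub n G).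

Definition gnp_weight (R : realType) n (p : R) (G : graph n) : R :=
  \prod_(e : edge n) (if e \in G then p else 1 - p).

Definition gnp_prob (R : realType) n (p : R) (A : graph n -> Prop) : R :=
  \sum_(G : graph n | `[< A G >]) gnp_weight p G.

Definition almost_always (R : realType) (p : nat -> R)
    (A : forall n, graph n -> Prop) : Prop :=
  (fun n => gnp_prob (p n) (A n)) @ \oo --> (1 : R).

(* Main.v *)
(* A placement of 2(k+1) vertices u_i, v_i such that any two of them are adjacent
   except possibly u_i and v_i, and such that no vertex is adjacent to all the
   u_i, gives everything.  Let Y be the boundary of the cross-polytope with
   antipodal pairs {u_i, v_i}.  Sending each vertex x other than the u_j to some
   v_i with x not adjacent to u_i is a simplicial retraction of X(n,p) onto Y:
   only u_i itself is sent to u_i, so no edge is sent to {u_i, v_i}.  Moreover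
   {u_0, ..., u_k} is a maximal face, so that taking its coefficient is a
   functional on H_k, with value 1 on the fundamental cycle of Y.
   Such a placement exists almost always by the second moment method.  The
   vertices are chosen in 2(k+1) disjoint blocks of m ~ n/2(k+1) vertices, and
   M is the number of copies of the 1-skeleton of Y.  That graph is 2k-regular,
   so two copies which share s vertices share at most ks edges, whence
   E M^2 <= (1 + 1/(m p^k))^(2(k+1)) (E M)^2.  The expected number of pairs of a
   copy and a vertex adjacent to all its u_i is at most
   (n p^(k+1) + (k+1) p) E M, and p <= n p^(k+1) as soon as n p^k >= 1. *)
From HB Require Import structures.
Require Import Defs.
From mathcomp Require Import all_boot all_order all_algebra.
From mathcomp Require Import all_classical all_reals all_analysis.
From mathcomp Require Import zify ring lra.
Import Order.TTheory GRing.Theory Num.Theory.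
Import numFieldNormedType.Exports.

Set Implicit Arguments.
Unset Strict Implicit.
Unset Printing Implicit Defensive.

Local Open Scope classical_set_scope.
Local Open Scope ring_scope.

(** * Homology *)

Definition additive_ker (H : zmodType) (f : {additive H -> int}) : {pred H} :=
  [pred x | f x == 0].

Lemma additive_ker_zmod_closed (H : zmodType) (f : {additive H -> int}) :
  zmod_closed (additive_ker f).
Proof.
split=> [|x y]; rewrite !inE ?raddf0 //.
by move=> /eqP fx0 /eqP fy0; rewrite raddfB /= fx0 fy0 subr0.
Qed.

HB.instance Definition _ (H : zmodType) (f : {additive H -> int}) :=
  GRing.isZmodClosed.Build H (additive_ker f) (@additive_ker_zmod_closed H f).

Record ker_type (H : zmodType) (f : {additive H -> int}) := KerElt {
  ker_val :> H;
  _ : ker_val \in additive_ker f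
}.
HB.instance Definition _ (H : zmodType) (f : {additive H -> int}) :=
  [isSub for @ker_val H f].
HB.instance Definition _ (H : zmodType) (f : {additive H -> int}) :=
  [Choice of ker_type f by <:].
HB.instance Definition _ (H : zmodType) (f : {additive H -> int}) :=
  [SubChoice_isSubZmodule of ker_type f by <:].

(** The decomposition [x = z *~ f x + (x - z *~ f x)] exhibits [H] as the direct sum of the
    multiples of [z] and the kernel of [f]. *)
Lemma has_Z_summand_split (H : zmodType) (f : {additive H -> int}) (z : H) :
  f z = 1 -> has_Z_summand H.
Proof.
move=> fz1; exists (ker_type f : zmodType).
pose g (x : (int * ker_type f)%type) : H := z *~ x.1 + val x.2.
have vB (x y : ker_type f) : ker_val (x - y) = ker_val x - ker_val y.
  exact: (raddfB (val : ker_type f -> H)).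
have gB : zmod_morphism g.
  move=> [a x] [b y]; rewrite /g /= mulrzBr opprD addrACA.
  by congr (_ + _); exact: vB.
pose G : {additive (int * ker_type f)%type -> H} := HB.pack g
  (GRing.isZmodMorphism.Build _ _ g gB).
have fzn a : f (z *~ a) = a by rewrite raddfMz fz1 intz.
have fK (x : ker_type f) : f (val x) = 0 by apply/eqP; exact: (valP x).
have hk x : x - z *~ f x \in additive_ker f by rewrite inE raddfB /= fzn subrr.
exists G; exists (fun x => (f x, Sub (x - z *~ f x) (hk x) : ker_type f)) => [[a x]|x].
- have fg : f (z *~ a + val x) = a by rewrite raddfD /= fzn fK addr0.
  rewrite /= /g /=; congr pair; first exact: fg.
  by apply: val_inj; rewrite SubK fg addrC addKr.
- by rewrite /= /g /= addrC subrK.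
Qed.

(** A boundary has coefficient 0 at a maximal face, so the coefficient at [s0] descends to homology,
    where it takes the value 1 on the class of [z]. *)
Lemma homology_Z_summand n (X : simplicial_complex n) k
    (z : chain X k.+1) (s0 : face X k.+1) :
  boundary z = 0 -> z s0 = 1 ->
  (forall s, s \in faces X -> val s0 \proper s -> False) ->
  has_Z_summand (reduced_homology X k).
Proof.
move=> bz0 z1 s0max.
have zc : z \in @is_cycle n X k by rewrite inE bz0.
have bd0 (c : cycles X k) : c \in @is_boundary n X k -> cycle_val c s0 = 0.
  rewrite inE => -[b bc]; rewrite -[cycle_val c]/(val c) -bc ffunE big1 // => s _.
  rewrite /incidence big_pred0 ?mul0r // => v.
  apply/negP => /andP[vs /eqP s0v].
  apply: (s0max (val s)); first by case/andP: (valP s).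
  by rewrite s0v properD1.
pose f (q : reduced_homology X k) : int := cycle_val (repr q) s0.
have fpi (c : cycles X k) : f (\pi_{ideal_quot (@is_boundary n X k)} c)%qT = cycle_val c s0.
  rewrite /f; case: piP => y /eqP.
  rewrite -Quotient.idealrBE => /bd0 /=.
  by rewrite !ffunE => /eqP; rewrite subr_eq0 => /eqP.
have fB : zmod_morphism f.
  move=> x y; rewrite -[x]reprK -[y]reprK -raddfB /= !fpi.
  by rewrite !ffunE.
pose F : {additive reduced_homology X k -> int} := HB.pack f
  (GRing.isZmodMorphism.Build _ _ f fB).
apply: (@has_Z_summand_split _ F (\pi_{ideal_quot (@is_boundary n X k)} (Cycle zc))%qT).
by rewrite /= fpi.
Qed.

(** * The fundamental cycle of the cross-polytope *)

(** The vertices [w i false] and [w i true] stand for u_i and v_i; [e] chooses one of the two for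
    each [i]. *)
Definition facet k n (w : 'I_k.+1 -> bool -> 'I_n)
    (e : {ffun 'I_k.+1 -> bool}) : {set 'I_n} :=
  [set w i (e i) | i : 'I_k.+1]%SET.

Section CrossPolytope.
Variables (k n : nat) (w : 'I_k.+1 -> bool -> 'I_n).
Hypothesis wlt : forall (i j : 'I_k.+1) a b, (i < j)%N -> (w i a < w j b)%N.
Hypothesis wneq : forall i, w i false != w i true.

Lemma w_inj i j a b : w i a = w j b -> i = j /\ a = b.
Proof.
move=> wij; case: (ltngtP i j) => [/wlt|/wlt|/val_inj ij].
- by move=> /(_ a b); rewrite wij ltnn.
- by move=> /(_ b a); rewrite wij ltnn.
- split=> //; move: wij; rewrite ij; have := wneq j.
  by case: a; case: b => // /negP H /eqP; rewrite // eq_sym.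
Qed.

Lemma w_facet i a e : (w i a \in facet w e) = (a == e i).
Proof.
apply/imsetP/eqP => [[j _ /w_inj[-> ->]] //|->]; by exists i.
Qed.

Lemma card_facet e : #|facet w e| = k.+1.
Proof. by rewrite card_imset ?card_ord // => i j /w_inj[]. Qed.

(** The pairs occupy increasing ranges of vertices, so the position of a vertex in a facet depends
    only on its pair. Hence the sign of its removal is (-1)^i for every [e]. *)
Lemma facet_below e i :
  #|[set x in facet w e | (x < w i (e i))%N]%SET| = i.
Proof.
have -> : [set x in facet w e | (x < w i (e i))%N]%SET =
    [set w j (e j) | j : 'I_k.+1 in [set j : 'I_k.+1 | (j < i)%N]%SET]%SET.
  apply/setP => x; rewrite inE; apply/andP/imsetP => [[/imsetP[j _ ->]]|[j]].
    move=> wji; exists j => //; rewrite inE ltnNge; apply/negP.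
    rewrite leq_eqVlt => /orP[/eqP/val_inj ij|/(wlt (e i) (e j))].
      by move: wji; rewrite ij ltnn.
    by move: wji; lia.
  by rewrite inE => ji ->; rewrite w_facet eqxx (wlt _ _ ji).
rewrite card_imset; last by move=> j j' /w_inj[].
rewrite -[RHS](card_ord i) -[RHS](@card_imset _ _ (widen_ord (ltnW (ltn_ord i)))).
  apply: eq_card => j; rewrite !inE; apply/idP/imsetP => [ji|[j' _ ->]].
    by exists (Ordinal ji) => //; apply: val_inj.
  exact: (ltn_ord j').
by move=> j j' /(congr1 val) /= /val_inj.
Qed.

Lemma incidence_facet e t :
  incidence (facet w e) t =
  \sum_(i < k.+1) (if t == (facet w e :\ w i (e i))%SET then (-1) ^+ i else 0).
Proof.
rewrite /incidence /facet [LHS]big_mkcondr /= big_imset /=; last first.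
  by move=> i j _ _ /w_inj[].
by apply: eq_bigr => i _; rewrite -/(facet w e) facet_below.
Qed.

(* Each face of codimension one of the cross-polytope lies in exactly two
   facets, which differ in one coordinate and so have opposite signs. *)
Lemma sum_incidence_facet t :
  \sum_(e : {ffun 'I_k.+1 -> bool})
    (-1) ^+ (\sum_i e i)%N * incidence (facet w e) t = 0.
Proof.
under eq_bigr do rewrite incidence_facet mulr_sumr.
rewrite exchange_big big1 //= => i _.
pose flip (e : {ffun 'I_k.+1 -> bool}) : {ffun 'I_k.+1 -> bool} :=
  [ffun j => if j == i then ~~ e j else e j].
have flipK : involutive flip.
  by move=> e; apply/ffunP => j; rewrite !ffunE; case: eqP => // _; rewrite negbK.
set S := \sum_e _.
suff : S = - S by lia.
rewrite {1}/S (reindex_inj (inv_inj flipK)) -sumrN; apply: eq_bigr => e _.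
have -> : (facet w (flip e) :\ w i (flip e i) =
           facet w e :\ w i (e i))%SET.
  apply/setP => x; rewrite !inE.
  apply/andP/andP => -[xi /imsetP[j _ xj]]; move: xi; rewrite xj.
    have [->|ji] := eqVneq j i; first by rewrite eqxx.
    rewrite w_facet !ffunE (negbTE ji) eqxx; split=> //.
    by apply/eqP => /w_inj[/eqP]; rewrite (negbTE ji).
  have [->|ji] := eqVneq j i; first by rewrite eqxx.
  rewrite w_facet !ffunE (negbTE ji) eqxx; split=> //.
  by apply/eqP => /w_inj[/eqP]; rewrite (negbTE ji).
rewrite -mulNr; congr (_ * _).
rewrite (bigD1 i) // [in RHS](bigD1 i) //= !exprD ffunE eqxx.
have -> : (\sum_(j | j != i) flip e j = \sum_(j | j != i) e j)%N.
  by apply: eq_bigr => j ji; rewrite ffunE (negbTE ji).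
by case: (e i) => /=; rewrite ?expr0 ?expr1; ring.
Qed.

Variable X : simplicial_complex n.
Hypothesis Xw : forall e, facet w e \in faces X.
Hypothesis XU : forall x,
  (forall i, [set x; w i false]%SET \in faces X) -> exists i, x = w i false.

Lemma facet_face e :
  (facet w e \in faces X) && (#|facet w e| == k.+1).
Proof. by rewrite Xw card_facet eqxx. Qed.

(** The signed sum of the facets is a cycle with coefficient 1 at {u_0, ..., u_k}. A larger face
    would contain a further vertex joined to every u_i, which [XU] excludes, so this facet is
    maximal in [X]. *)
Lemma crosspolytope_homology : has_Z_summand (reduced_homology X k).
Proof.
pose tf e : face X k.+1 := Sub (facet w e) (facet_face e).
pose z : chain X k.+1 :=
  [ffun s => \sum_(e : {ffun 'I_k.+1 -> bool}) (-1) ^+ (\sum_i e i)%N * (s == tf e)%:R].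
apply: (@homology_Z_summand n X k z (tf [ffun=> false])).
- apply/ffunP => t; rewrite !ffunE -[RHS](sum_incidence_facet (val t)).
  under eq_bigr do rewrite ffunE mulr_sumr.
  rewrite exchange_big /=; apply: eq_bigr => e _.
  rewrite (bigD1 (tf e)) //= eqxx [X in _ + X]big1 ?addr0 => [|s stf].
    by rewrite mulr1 mulrC.
  by rewrite (negbTE stf) !mulr0.
- rewrite ffunE (bigD1 [ffun=> false]) //= eqxx [X in _ + X]big1 ?addr0 => [|e ne].
    by rewrite big1 ?expr0 ?mulr1 // => i _; rewrite ffunE.
  case: eqP => [/(congr1 val) /= te|]; last by rewrite mulr0.
  case/eqP: ne; apply/ffunP => i; apply/esym/eqP.
  by rewrite -w_facet -te w_facet.
- move=> s sX /properP[Us [x xs xU]].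
  have [|i xi] := XU (x := x).
    move=> i; apply: faces_sub sX; apply/fintype.subsetP => y.
    rewrite !inE => /orP[]/eqP-> //; apply: (fintype.subsetP Us).
    by rewrite /= w_facet ffunE.
  by move: xU; rewrite xi /= w_facet ffunE.
Qed.
End CrossPolytope.

(** * Retraction onto the cross-polytope *)

Lemma continuous_rV (R : realType) (T : topologicalType) m (f : T -> 'rV[R]_m) x :
  (forall j, {for x, continuous (fun y => f y ord0 j)}) -> {for x, continuous f}.
Proof.
move=> fc; apply/cvg_ballP => e e0.
near=> y; split => // i j; rewrite (ord1 i).
move: j; near: y; apply: filter_forall => j.
exact: (cvg_ball (fc j) e0).
Unshelve. all: by end_near. Qed.

Lemma continuous_sum_for (R : realType) (T : topologicalType) (I : finType)
    (P : pred I) (F : I -> T -> R) x :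
  (forall i, P i -> {for x, continuous (F i)}) ->
  {for x, continuous (fun y => \sum_(i | P i) F i y)}.
Proof. by move=> Fc; apply: cvg_big => //; apply: add_continuous. Qed.

Section CrossPolytopeTopology.
Variables (R : realType) (k n : nat) (w : 'I_k.+1 -> bool -> 'I_n).
Hypothesis wlt : forall (i j : 'I_k.+1) a b, (i < j)%N -> (w i a < w j b)%N.
Hypothesis wneq : forall i, w i false != w i true.

Definition crosspolytope_faces : {set {set 'I_n}} :=
  finset (fun s : {set 'I_n} => [exists e, s \subset facet w e]).

Lemma crosspolytope_faces0 : finset.set0 \in crosspolytope_faces.
Proof. by rewrite inE; apply/existsP; exists [ffun=> false]; rewrite finset.sub0set. Qed.

Lemma crosspolytope_faces_sub (s t : {set 'I_n}) :
  t \subset s -> s \in crosspolytope_faces -> t \in crosspolytope_faces.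
Proof.
rewrite !inE => ts /existsP[e se]; apply/existsP; exists e.
exact: fintype.subset_trans ts se.
Qed.

Definition crosspolytope : simplicial_complex n :=
  Complex crosspolytope_faces0 crosspolytope_faces_sub.

Lemma crosspolytope_support (x : 'rV[R]_n) : realization R crosspolytope x ->
  exists e, forall i, x ord0 i != 0 -> i \in facet w e.
Proof.
case=> _ _; rewrite inE => /existsP[e /fintype.subsetP xe]; exists e => i xi.
by apply: xe; rewrite inE.
Qed.

(** The i-th pair is put on the i-th axis, with u_i on the positive side. This turns the realization
    into the unit sphere of the 1-norm, which [to_sphere] projects radially to the Euclidean one. *)
Definition to_sphere_vec (x : 'rV[R]_n) : 'rV[R]_k.+1 :=
  \row_i (x ord0 (w i false) - x ord0 (w i true)).

Definition to_sphere (x : 'rV[R]_n) : 'rV[R]_k.+1 :=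
  (Num.sqrt (\sum_i to_sphere_vec x ord0 i ^+ 2))^-1 *: to_sphere_vec x.

(** Positive parts of the coordinates become weights of the u_i, negative parts weights of the
    v_i. *)
Definition of_sphere_vec (z : 'rV[R]_k.+1) : 'rV[R]_n :=
  \row_j \sum_i (Num.max (z ord0 i) 0 *+ (w i false == j) +
                 Num.max (- z ord0 i) 0 *+ (w i true == j)).

Definition of_sphere (z : 'rV[R]_k.+1) : 'rV[R]_n :=
  (\sum_i `|z ord0 i|)^-1 *: of_sphere_vec z.

Lemma of_sphere_vecE z i a :
  of_sphere_vec z ord0 (w i a) = Num.max ((-1) ^+ a * z ord0 i) 0.
Proof.
rewrite mxE (bigD1 i) //= big1 ?addr0 => [|j ji].
  have wi : (w i false == w i true) = false := negbTE (wneq i).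
  case: a; rewrite eqxx.
    by rewrite wi expr1 mulN1r mulr0n add0r mulr1n.
  by rewrite eq_sym wi expr0 mul1r mulr0n addr0 mulr1n.
have wji b c : (w j b == w i c) = false.
  by apply/eqP => /(w_inj wlt wneq)[/eqP]; rewrite (negbTE ji).
by rewrite !wji !mulr0n addr0.
Qed.

(** The signs of [z] select the facet. A zero coordinate may be assigned to either side, since it
    puts no weight on its pair. *)
Lemma of_sphere_vec_support z j : of_sphere_vec z ord0 j != 0 ->
  j \in facet w [ffun i => z ord0 i < 0].
Proof.
have [[[i a] ->]|nj] := pselect (exists ia : 'I_k.+1 * bool, j = w ia.1 ia.2).
  rewrite of_sphere_vecE (w_facet wlt wneq) ffunE /=.
  case: (ltP (z ord0 i) 0) => zi; case: a => //.
    by rewrite expr0 mul1r max_r ?(ltW zi) // eqxx.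
  by rewrite expr1 mulN1r max_r ?oppr_le0 // eqxx.
rewrite mxE big1 ?eqxx // => i _.
have wj a : (w i a == j) = false.
  by apply/eqP => ji; apply: nj; exists (i, a).
by rewrite !wj !mulr0n addr0.
Qed.

Lemma of_sphere_vec_sum z : \sum_j of_sphere_vec z ord0 j = \sum_i `|z ord0 i|.
Proof.
under eq_bigr do rewrite mxE.
rewrite exchange_big /=; apply: eq_bigr => i _; rewrite big_split /=.
have delta (a : R) (l : 'I_n) : \sum_j a *+ (l == j) = a.
  rewrite (bigD1 l) //= eqxx big1 ?addr0 // => j; rewrite eq_sym.
  by move=> /negbTE ->.
rewrite !delta; case: (ltP (z ord0 i) 0) => zi.
  by rewrite ltr0_norm // add0r max_l // oppr_ge0 ltW.
by rewrite ger0_norm // max_r ?addr0 // oppr_le0.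
Qed.

Lemma sphere_norm1_gt0 (z : 'rV[R]_k.+1) : sphere R k z -> 0 < \sum_i `|z ord0 i|.
Proof.
move=> zS; rewrite lt_neqAle sumr_ge0 // andbT eq_sym; apply/negP => /eqP z0.
have zi i : z ord0 i = 0.
  have /psumr_eq0P := z0; move=> /(_ (fun _ _ => normr_ge0 _) i isT).
  by move/eqP; rewrite normr_eq0 => /eqP.
move: zS; rewrite /sphere /= big1 => [/eqP|i _]; last by rewrite zi expr0n.
by rewrite eq_sym oner_eq0.
Qed.

Lemma of_sphere_in z : sphere R k z -> realization R crosspolytope (of_sphere z).
Proof.
move=> /sphere_norm1_gt0 z0; split => [j||].
- rewrite mxE mulr_ge0 ?invr_ge0 ?(ltW z0) // mxE sumr_ge0 // => i _.
  by rewrite addr_ge0 // mulrn_wge0 // le_max lexx orbT.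
- under eq_bigr do rewrite mxE.
  by rewrite -mulr_sumr of_sphere_vec_sum mulVf // gt_eqF.
- rewrite inE; apply/existsP; exists [ffun i => z ord0 i < 0].
  apply/fintype.subsetP => j; rewrite inE mxE mulf_eq0 negb_or => /andP[_].
  exact: of_sphere_vec_support.
Qed.

(* On a face at most one vertex of each antipodal pair carries weight, so that
   positive and negative parts of the differences recover the weights. *)
Lemma crosspolytope_pos_part x i a : realization R crosspolytope x ->
  x ord0 (w i a) = Num.max ((-1) ^+ a * to_sphere_vec x ord0 i) 0.
Proof.
move=> xY; have [e xe] := crosspolytope_support xY; case: xY => x0 _ _.
have xN : x ord0 (w i (~~ e i)) = 0.
  apply/eqP/negPn/negP => /xe; rewrite (w_facet wlt wneq).
  by case: (e i).
rewrite mxE; have := x0 (w i false); have := x0 (w i true).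
move: xN; case: (e i); case: a => /= ->; rewrite ?expr0 ?expr1 maxEle;
  by case: ifP => ?; lra.
Qed.

(** Positive parts recover all weights, so [of_sphere_vec] undoes [to_sphere_vec]; as it turns the
    1-norm into the sum of the weights, that norm is 1. *)
Lemma crosspolytope_norm1 x : realization R crosspolytope x ->
  \sum_i `|to_sphere_vec x ord0 i| = 1 /\ of_sphere_vec (to_sphere_vec x) = x.
Proof.
move=> xY.
have xE : of_sphere_vec (to_sphere_vec x) = x.
  apply/rowP => j.
  have [[[i a] ->]|nj] := pselect (exists ia : 'I_k.+1 * bool, j = w ia.1 ia.2).
    by rewrite of_sphere_vecE -crosspolytope_pos_part.
  have [e xe] := crosspolytope_support xY.
  have out (y : 'rV[R]_n) e' :
      (y ord0 j != 0 -> j \in facet w e') -> y ord0 j = 0.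
    move=> ye; apply/eqP/negPn/negP => /ye /imsetP[i _ ji].
    by apply: nj; exists (i, e' i).
  by rewrite (out _ _ (@of_sphere_vec_support _ j)) (out _ _ (xe j)).
by split=> //; rewrite -of_sphere_vec_sum xE; case: xY.
Qed.

Lemma sqr_norm_gt0 (y : 'rV[R]_k.+1) :
  0 < \sum_i `|y ord0 i| -> 0 < \sum_i y ord0 i ^+ 2.
Proof.
move=> y0; rewrite lt_neqAle sumr_ge0 ?andbT => [|i _]; last exact: sqr_ge0.
rewrite eq_sym; apply/eqP => s0; move: y0; rewrite big1 ?ltxx // => i _.
have /psumr_eq0P := s0; move=> /(_ (fun _ _ => sqr_ge0 _) i isT)/eqP.
by rewrite sqrf_eq0 => /eqP ->; rewrite normr0.
Qed.

Lemma to_sphere_vecZ a x : to_sphere_vec (a *: x) = a *: to_sphere_vec x.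
Proof. by apply/rowP => i; rewrite !mxE mulrBr. Qed.

Lemma of_sphere_vecZ a z : 0 <= a -> of_sphere_vec (a *: z) = a *: of_sphere_vec z.
Proof.
move=> a0; apply/rowP => j; rewrite !mxE mulr_sumr; apply: eq_bigr => i _.
have maxM t : Num.max (a * t) 0 = a * Num.max t 0 by rewrite maxr_pMr // mulr0.
by rewrite mxE -mulrN !maxM mulrDr !mulrnAr.
Qed.

Lemma to_of_sphere_vec z : to_sphere_vec (of_sphere_vec z) = z.
Proof.
apply/rowP => i; rewrite mxE !of_sphere_vecE expr0 expr1 !maxEle.
by do 2! case: ifP => ?; lra.
Qed.

(** Each map is positively homogeneous up to a final rescaling. The homogeneous parts are mutually
    inverse, and the norm condition on each side makes the two scaling factors cancel. *)
Lemma crosspolytope_homeomorphic :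
  homeomorphic (realization R crosspolytope) (sphere R k).
Proof.
exists to_sphere, of_sphere; split.
- apply: continuous_in_subspaceT => x /set_mem xY.
  have [x1 _] := crosspolytope_norm1 xY.
  have vc j : {for x, continuous (fun y => to_sphere_vec y ord0 j)}.
    rewrite (_ : (fun _ => _) =
      (fun y : 'rV[R]_n => y ord0 (w j false)) - (fun y => y ord0 (w j true))).
      by apply: continuousB; apply: coord_continuous.
    by apply/funext => y; rewrite mxE.
  apply: continuous_rV => j.
  rewrite (_ : (fun _ => _) =
    (fun y => (Num.sqrt (\sum_i to_sphere_vec y ord0 i ^+ 2))^-1) \*
    (fun y => to_sphere_vec y ord0 j)); last by apply/funext => y; rewrite mxE.
  apply: continuousM => //; apply: continuousV.
    by rewrite sqrtr_eq0 -ltNge sqr_norm_gt0 // x1 ltr01.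
  apply: (@continuous_comp _ _ _ _ (@Num.sqrt R)); last exact: sqrt_continuous.
  apply: continuous_sum_for => i _.
  apply: (@continuous_comp _ _ _ _ (@GRing.exp R ^~ 2%N)) => //.
  exact: exprn_continuous.
- apply: continuous_in_subspaceT => z /set_mem zS.
  apply: continuous_rV => j.
  rewrite (_ : (fun _ => _) =
    (fun y : 'rV[R]_k.+1 => (\sum_i `|y ord0 i|)^-1) \*
    (fun y => of_sphere_vec y ord0 j)); last by apply/funext => y; rewrite mxE.
  apply: continuousM.
    apply: continuousV; first by rewrite gt_eqF // sphere_norm1_gt0.
    apply: continuous_sum_for => i _.
    apply: (@continuous_comp _ _ _ _ (@Num.norm R R)); last exact: norm_continuous.
    exact: coord_continuous.
  rewrite (_ : (fun _ => _) = fun z : 'rV[R]_k.+1 =>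
      \sum_i (Num.max (z ord0 i) 0 *+ (w i false == j) +
              Num.max (- z ord0 i) 0 *+ (w i true == j))); last first.
    by apply/funext => y; rewrite mxE.
  have cmax (f : 'rV[R]_k.+1 -> R) (b : bool) : {for z, continuous f} ->
      {for z, continuous (fun y => Num.max (f y) 0 *+ b)}.
    have c0 : {for z, continuous (fun=> 0 : R)} by exact: cst_continuous.
    move=> fc; case: b => //=.
    exact: (continuous_max fc c0).
  apply: continuous_sum_for => i _.
  apply: continuousD; apply: cmax; first exact: coord_continuous.
  by apply: continuousN; apply: coord_continuous.
- move=> x xY; have [x1 _] := crosspolytope_norm1 xY.
  have s0 : 0 < \sum_i to_sphere_vec x ord0 i ^+ 2 by rewrite sqr_norm_gt0 ?x1.
  rewrite /sphere /=; under eq_bigr do rewrite mxE exprMn.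
  by rewrite -mulr_sumr exprVn sqr_sqrtr ?(ltW s0) // mulVf // gt_eqF.
- exact: of_sphere_in.
- split=> [x xY|z zS].
    have [x1 xE] := crosspolytope_norm1 xY.
    have s0 : 0 < \sum_i to_sphere_vec x ord0 i ^+ 2 by rewrite sqr_norm_gt0 ?x1.
    have i0 : 0 < (Num.sqrt (\sum_i to_sphere_vec x ord0 i ^+ 2))^-1.
      by rewrite invr_gt0 sqrtr_gt0.
    rewrite /of_sphere /to_sphere of_sphere_vecZ ?(ltW i0) // xE scalerA.
    under eq_bigr do rewrite mxE normrM (gtr0_norm i0).
    by rewrite -mulr_sumr x1 mulr1 mulVf ?scale1r // gt_eqF.
  have z0 := sphere_norm1_gt0 zS.
  rewrite /to_sphere /of_sphere to_sphere_vecZ to_of_sphere_vec scalerA.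
  under eq_bigr do rewrite mxE exprMn.
  rewrite -mulr_sumr zS mulr1 sqrtr_sqr gtr0_norm ?invr_gt0 // invrK.
  by rewrite mulfV ?scale1r // gt_eqF.
Qed.

(** * The simplicial retraction *)

Variable X : simplicial_complex n.
Hypothesis Xw : forall e, facet w e \in faces X.
Hypothesis XU : forall x,
  (forall i, [set x; w i false]%SET \in faces X) -> exists i, x = w i false.

(** Under [XU] the default [x] is returned only when [x] is one of the u_j. *)
Definition retract_vertex (x : 'I_n) : 'I_n :=
  if [pick i | [set x; w i false]%SET \notin faces X] is Some i then w i true else x.

(** A vertex of the i-th pair spans a face with every other u_j, so only the index [i] can be
    picked; for u_i itself not even that one, since {u_i} is a face. *)
Lemma retract_vertex_id i a : retract_vertex (w i a) = w i a.
Proof.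
rewrite /retract_vertex; case: pickP => // j.
have [->|ji] := eqVneq j i; last first.
  move=> /negP[]; pose e := [ffun l => if l == i then a else false].
  apply: faces_sub (Xw e); apply/fintype.subsetP => x.
  by rewrite !inE => /orP[]/eqP->; rewrite (w_facet wlt wneq) ffunE ?eqxx // (negbTE ji).
case: a => // /negP[]; apply: faces_sub (Xw [ffun=> false]).
apply/fintype.subsetP => x.
by rewrite !inE => /orP[]/eqP->; rewrite (w_facet wlt wneq) ffunE.
Qed.

(** The facet taking u_i when u_i is in [s] and v_i otherwise contains the image: a vertex of [s] is
    moved to v_i only if it spans no face with u_i, and then u_i is not in [s]. *)
Lemma retract_vertex_face (s : {set 'I_n}) : s \in faces X ->
  (retract_vertex @: s)%SET \in faces crosspolytope.
Proof.
move=> sX; rewrite inE; apply/existsP; exists [ffun i => w i false \notin s].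
apply/fintype.subsetP => _ /imsetP[y ys ->].
have [[i yi]|nU] := pselect (exists i, y = w i false).
  by move: ys; rewrite yi retract_vertex_id (w_facet wlt wneq) ffunE => ->.
rewrite /retract_vertex; case: pickP => [i yi|all].
  rewrite (w_facet wlt wneq) ffunE eq_sym eqb_id.
  apply/negP => wis; move/negP: yi; apply; apply: faces_sub sX.
  by apply/fintype.subsetP => x; rewrite !inE => /orP[]/eqP->.
by case: nU; apply: XU => i; have /negbFE := all i.
Qed.

(** The affine extension of the vertex map: barycentric weights are pushed forward. *)
Definition retract_realization (x : 'rV[R]_n) : 'rV[R]_n :=
  \row_j \sum_(i | retract_vertex i == j) x ord0 i.

Lemma crosspolytope_retract : retracts_onto_sphere R X k.
Proof.
have YX : subcomplex crosspolytope X.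
  apply/fintype.subsetP => s; rewrite inE => /existsP[e se].
  exact: faces_sub se (Xw e).
exists crosspolytope; split=> //; last exact: crosspolytope_homeomorphic.
split; first by move=> x [x0 x1 xs]; split=> //; apply: (fintype.subsetP YX).
exists retract_realization; split.
- apply: continuous_in_subspaceT => x _; apply: continuous_rV => j.
  rewrite (_ : (fun _ => _) = fun y : 'rV[R]_n =>
    \sum_(i | retract_vertex i == j) y ord0 i).
    by apply: continuous_sum_for => i _; apply: coord_continuous.
  by apply/funext => y; rewrite mxE.
- move=> x [x0 x1 xs]; split=> [j||].
  + by rewrite mxE sumr_ge0.
  + under eq_bigr do rewrite mxE.
    by rewrite -[RHS]x1 [RHS](partition_big retract_vertex xpredT).
  + apply: faces_sub (retract_vertex_face xs).
    apply/fintype.subsetP => j; rewrite inE mxE => xj.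
    have [/existsP[i /andP[/eqP <- xi]]|] :=
        boolP [exists i, (retract_vertex i == j) && (x ord0 i != 0)].
      by apply: imset_f; rewrite inE.
    rewrite negb_exists => /forallP nx; case/eqP: xj; apply: big1 => i ij.
    by have := nx i; rewrite ij /= negbK => /eqP.
(* The support of a point of the cross-polytope consists of fixed vertices, so only the term [i = j]
   can contribute. *)
- move=> x xY; have [e xe] := crosspolytope_support xY.
  apply/rowP => j; rewrite mxE big_mkcond /= (bigD1 j) //= big1 ?addr0.
    case: eqP => // rj; apply/esym/eqP/negPn/negP => /xe /imsetP[i _ ji].
    by apply: rj; rewrite ji retract_vertex_id.
  move=> i ij; case: eqP => // rij; apply/eqP/negPn/negP => /xe /imsetP[l _ il].
  by move: ij; rewrite -rij il retract_vertex_id eqxx.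
Qed.
End CrossPolytopeTopology.

(** * Random graphs *)

Section RandomGraph.
Variables (R : realType) (n : nat) (p : R).
Hypothesis p01 : 0 <= p <= 1.

Lemma gnp_weight_ge0 (G : graph n) : 0 <= gnp_weight p G.
Proof.
by have /andP[p0 p1] := p01; apply: prodr_ge0 => e _; case: ifP; rewrite ?subr_ge0.
Qed.

(** The probability that all edges of [S] are present. The indicator is absorbed by giving weight 0
    to the absence of an edge of [S]; the sum then factors over the edges, into p on [S] and p + (1
    - p) elsewhere. *)
Lemma sum_gnp_weight_sub (S : {set edge n}) :
  \sum_(G : graph n) gnp_weight p G * (S \subset G)%:R = p ^+ #|S|.
Proof.
transitivity (\sum_(G : graph n)
    \prod_e (if e \in G then p else if e \in S then 0 else 1 - p)).
  apply: eq_bigr => G _; rewrite /gnp_weight.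
  case: (boolP (S \subset G)) => [/fintype.subsetP SG|/subsetPn[e eS eG]].
    rewrite mulr1; apply: eq_bigr => e _; case: ifP => // /negbT eG.
    by case: ifP => // /SG; rewrite (negbTE eG).
  by rewrite mulr0 (bigD1 e) //= (negbTE eG) eS mul0r.
rewrite -bigA_distr -prodr_const [RHS]big_mkcond /=; apply: eq_bigr => e _.
by case: ifP => _; [rewrite addr0|rewrite addrC subrK].
Qed.

Lemma sum_gnp_weight : \sum_(G : graph n) gnp_weight p G = 1.
Proof.
have := sum_gnp_weight_sub finset.set0; rewrite cards0 expr0 => <-.
by apply: eq_bigr => G _; rewrite finset.sub0set mulr1.
Qed.

Lemma gnp_prob_le1 (A : graph n -> Prop) : gnp_prob p A <= 1.
Proof.
rewrite -sum_gnp_weight [leRHS](bigID (fun G => `[< A G >])) /= lerDl.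
by apply: sumr_ge0 => G _; apply: gnp_weight_ge0.
Qed.

(* Chebyshev's inequality for [M], combined with Markov's for [B]. *)
Lemma gnp_prob_second_moment (A : graph n -> Prop) (M B : graph n -> R) mu v b :
  0 < mu -> (forall G, 0 <= B G) -> (forall G, ~ A G -> M G <= B G) ->
  \sum_G gnp_weight p G * M G = mu ->
  \sum_G gnp_weight p G * M G ^+ 2 <= mu ^+ 2 * v ->
  \sum_G gnp_weight p G * B G <= mu * b ->
  1 - (4 * (v - 1) + 2 * b) <= gnp_prob p A.
Proof.
move=> mu0 B0 MB EM EM2 EB.
(* If [A] fails, either M <= mu/2 and the first quotient is at least 1, or B >= M > mu/2 and the
   second one is. *)
have key G : 1 - (4 * (M G - mu) ^+ 2 / mu ^+ 2 + 2 * B G / mu) <= (`[< A G >])%:R.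
  case: asboolP => [_|/MB MBG] /=.
    rewrite gerBl; apply: addr_ge0; apply: divr_ge0; rewrite ?sqr_ge0 ?(ltW mu0) //.
      by rewrite mulr_ge0 // sqr_ge0.
    by rewrite mulr_ge0.
  rewrite subr_le0.
  have -> : 4 * (M G - mu) ^+ 2 / mu ^+ 2 + 2 * B G / mu =
            (4 * (M G - mu) ^+ 2 + 2 * B G * mu) / mu ^+ 2.
    by field; rewrite gt_eqF.
  rewrite ler_pdivlMr ?exprn_gt0 // mul1r.
  have := B0 G; set b' := B G in MBG *; set m := M G in MBG *.
  have [mh|mh] := leP m (mu / 2) => b0.
    have : (mu / 2) ^+ 2 <= (mu - m) ^+ 2 by rewrite ler_sqr ?nnegrE; lra.
    have : 0 <= b' * mu by rewrite mulr_ge0 // ltW.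
    by rewrite !expr2; lra.
  have : mu / 2 * mu <= b' * mu by rewrite ler_pM2r //; lra.
  by have := sqr_ge0 (m - mu); rewrite !expr2; lra.
have -> : gnp_prob p A = \sum_G gnp_weight p G * (`[< A G >])%:R.
  rewrite /gnp_prob big_mkcond; apply: eq_bigr => G _.
  by case: ifP; rewrite ?mulr1 ?mulr0.
apply: (@le_trans _ _ (\sum_G gnp_weight p G *
    (1 - (4 * (M G - mu) ^+ 2 / mu ^+ 2 + 2 * B G / mu)))); last first.
  by apply: ler_sum => G _; rewrite ler_wpM2l ?gnp_weight_ge0.
have -> : \sum_G gnp_weight p G *
    (1 - (4 * (M G - mu) ^+ 2 / mu ^+ 2 + 2 * B G / mu)) =
  1 - 4 / mu ^+ 2 * (\sum_G gnp_weight p G * M G ^+ 2)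
    + 8 / mu * (\sum_G gnp_weight p G * M G) - 4
    - 2 / mu * (\sum_G gnp_weight p G * B G).
  transitivity (\sum_G (gnp_weight p G - 4 / mu ^+ 2 * (gnp_weight p G * M G ^+ 2)
    + 8 / mu * (gnp_weight p G * M G) - 4 * gnp_weight p G
    - 2 / mu * (gnp_weight p G * B G))).
    by apply: eq_bigr => G _; field; rewrite gt_eqF.
  by rewrite !(sumrB, big_split) /= -!mulr_sumr sum_gnp_weight mulr1.
rewrite EM.
have h1 : 4 / mu ^+ 2 * (\sum_G gnp_weight p G * M G ^+ 2) <= 4 * v.
  have -> : 4 * v = 4 / mu ^+ 2 * (mu ^+ 2 * v) by field; rewrite gt_eqF.
  by rewrite ler_wpM2l // divr_ge0 // exprn_ge0 // ltW.
have h2 : 2 / mu * (\sum_G gnp_weight p G * B G) <= 2 * b.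
  have -> : 2 * b = 2 / mu * (mu * b) by field; rewrite gt_eqF.
  by rewrite ler_wpM2l // divr_ge0 // ltW.
have h3 : 8 / mu * mu = 8 by rewrite mulfVK // gt_eqF.
by lra.
Qed.

(** Lets edge sets be computed as plain sets of vertex sets, without carrying cardinality proofs;
    members that are not pairs are dropped. *)
Definition edges_of (T : {set {set 'I_n}}) : {set edge n} :=
  finset (fun e : edge n => val e \in T).

Lemma card_edges_of (T : {set {set 'I_n}}) :
  (forall s, s \in T -> #|s| = 2%N) -> #|edges_of T| = #|T|.
Proof.
move=> T2; rewrite -(card_imset _ val_inj); apply: eq_card => s.
apply/imsetP/idP => [[e] |sT]; first by rewrite inE => eT ->.
have s2 : #|s| == 2%N by rewrite T2.
by exists (Sub s s2 : edge n); rewrite ?inE SubK.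
Qed.

Lemma edges_ofU (T T' : {set {set 'I_n}}) : edges_of (T :|: T') = (edges_of T :|: edges_of T')%SET.
Proof. by apply/setP => e; rewrite !inE. Qed.

End RandomGraph.

(** * The 1-skeleton of the cross-polytope *)

Section CocktailParty.
Variable k : nat.
Local Notation V := ('I_k.+1 * bool)%type.

Definition cocktail_edges : {set {set V}} :=
  [set [set vw.1; vw.2]%SET | vw : V * V in finset (fun vw : V * V => vw.1.1 != vw.2.1)]%SET.

Lemma cocktail_edgesP h :
  reflect (exists v w : V, v.1 != w.1 /\ h = [set v; w]%SET) (h \in cocktail_edges).
Proof.
apply: (iffP imsetP) => [[[v w]]|[v [w [vw ->]]]].
  by rewrite inE => vw ->; exists v, w.
by exists (v, w); rewrite // inE.
Qed.

Lemma card_cocktail_edge h : h \in cocktail_edges -> #|h| = 2%N.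
Proof.
move=> /cocktail_edgesP[v [w [vw ->]]].
by rewrite cards2 (_ : v != w) //; apply: contraNneq vw => ->.
Qed.

Lemma cocktail_degree v : (#|[set h in cocktail_edges | v \in h]%SET| <= 2 * k)%N.
Proof.
have c1 : #|finset (fun w : V => w.1 != v.1)| = (2 * k)%N.
  have -> : finset (fun w : V => w.1 != v.1) = finset.setX (~: [set v.1])%SET [set: bool]%SET.
    by apply/setP => w; rewrite !inE andbT.
  by rewrite cardsX cardsT card_bool cardsC1 card_ord /= mulnC.
rewrite -c1; apply: leq_trans (leq_imset_card (fun w => [set v; w]%SET) _).
apply/subset_leq_card/fintype.subsetP => h; rewrite inE => /andP[].
move=> /cocktail_edgesP[x [y [xy ->]]]; rewrite !inE => /orP[]/eqP ->.
  by apply/imsetP; exists y; rewrite // inE eq_sym.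
by apply/imsetP; exists x; rewrite ?inE // finset.setUC.
Qed.

(** Double counting: each edge inside [S] has two ends in [S], and each vertex has degree at most
    2k. *)
Lemma cocktail_induced (S : {set V}) :
  (#|[set h in cocktail_edges | h \subset S]%SET| <= k * #|S|)%N.
Proof.
set D := finset _; suff : (2 * #|D| <= 2 * (k * #|S|))%N by rewrite leq_pmul2l.
have -> : (2 * #|D| = \sum_(h in D) \sum_(v in S) (v \in h))%N.
  rewrite mulnC -sum_nat_const; apply: eq_bigr => h; rewrite inE => /andP[hE hS].
  rewrite -(card_cocktail_edge hE) -sum1_card big_mkcond [RHS]big_mkcond /=.
  apply: eq_bigr => v _; case: (boolP (v \in h)) => [/(fintype.subsetP hS) -> //|_].
  by case: ifP.
rewrite exchange_big /= mulnA mulnC -sum_nat_const; apply: leq_sum => v _.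
apply: leq_trans (cocktail_degree v); rewrite -sum1_card.
rewrite [leqRHS]big_mkcond [leqLHS]big_mkcond /=; apply: leq_sum => h _.
rewrite !inE; case: (h \in cocktail_edges) => //=.
by case: (v \in h); case: ifP.
Qed.
End CocktailParty.

(** * Copies of the 1-skeleton in a random graph and their moments *)

Section OctahedralCopies.
Variables (R : realType) (k n m : nat) (p : R).
Local Notation V := ('I_k.+1 * bool)%type.
Variable iota : V -> 'I_m -> 'I_n.
Hypothesis iota_inj : forall v v' a a', iota v a = iota v' a' -> v = v' /\ a = a'.
Hypothesis iota_lt : forall (v v' : V) a a',
  (v.1 < v'.1)%N -> (iota v a < iota v' a')%N.

(** A placement picks one vertex in each block, so a vertex of the graph can play only one role, the
    same in all copies. *)
Definition place (f : {ffun V -> 'I_m}) (v : V) : 'I_n := iota v (f v).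

Lemma place_inj f : injective (place f).
Proof. by move=> v v' /iota_inj[]. Qed.

Definition copy_edges f : {set {set 'I_n}} :=
  [set (place f @: (h : {set V}))%SET | h in cocktail_edges k]%SET.

Definition star_edges f (x : 'I_n) : {set {set 'I_n}} :=
  [set [set x; place f (i, false)]%SET | i : 'I_k.+1]%SET.

(** Excluding the u_i keeps all members of [star_edges] genuine pairs; the v_i remain allowed. *)
Definition off_base f : pred 'I_n := fun x => [forall i, x != place f (i, false)].

Lemma card_copy_edge f s : s \in copy_edges f -> #|s| = 2%N.
Proof.
move=> /imsetP[h hE ->]; rewrite card_imset; last exact: place_inj.
exact: card_cocktail_edge.
Qed.

Lemma card_star_edge f x s : off_base f x -> s \in star_edges f x -> #|s| = 2%N.
Proof. by move=> /forallP xf /imsetP[i _ ->]; rewrite cards2 xf. Qed.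

Lemma card_copy_edges f : #|copy_edges f| = #|cocktail_edges k|.
Proof. by rewrite card_imset //; apply: imset_inj; apply: place_inj. Qed.

(** As a vertex determines its role, a shared edge has both ends where [f] and [f'] agree, so
    [cocktail_induced] bounds the intersection. *)
Lemma card_copy_edgesU f f' :
  (2 * #|cocktail_edges k| <=
   #|copy_edges f :|: copy_edges f'| + k * #|[set v | f v == f' v]|)%SET%N.
Proof.
rewrite mul2n -addnn -{1}(card_copy_edges f) -(card_copy_edges f') -cardsUI leq_add2l.
set S := finset _; apply: leq_trans (cocktail_induced S).
apply: leq_trans (leq_imset_card (fun h : {set V} => place f @: h)%SET _).
apply/subset_leq_card/fintype.subsetP => s; rewrite inE => /andP[].
move=> /imsetP[h hE ->] /imsetP[h' h'E hh']; apply/imsetP; exists h => //.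
rewrite inE hE; apply/fintype.subsetP => v vh.
have /imsetP[v' _ /iota_inj[vv' fv]] : place f v \in (place f' @: h')%SET.
  by rewrite -hh' imset_f.
by rewrite inE fv vv'.
Qed.

Lemma card_star_edges f x : (forall v, x != place f v) ->
  #|copy_edges f :|: star_edges f x|%SET = (#|cocktail_edges k| + k.+1)%N.
Proof.
move=> xf; rewrite cardsU disjoint_setI0 ?cards0 ?subn0.
  rewrite card_copy_edges [X in (_ + X)%N]card_imset ?card_ord // => i j /setP ij.
  have := ij (place f (i, false)); rewrite !inE eqxx orbT eq_sym (negbTE (xf _)) /=.
  by move/esym/eqP => /place_inj[].
rewrite finset.disjoints_subset; apply/fintype.subsetP => s /imsetP[h _ ->]; rewrite inE.
apply/imsetP => -[i _ /setP/(_ x)]; rewrite !inE eqxx => /imsetP[v _ /eqP].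
by rewrite (negbTE (xf v)).
Qed.

(** For x = v_i the edge {u_i, v_i} is guaranteed to be new, since no copy contains an antipodal
    edge. *)
Lemma card_star_edges_antipode f i :
  (#|cocktail_edges k|.+1 <= #|copy_edges f :|: star_edges f (place f (i, true))|%SET)%N.
Proof.
pose s := [set place f (i, true); place f (i, false)]%SET.
have sC : s \notin copy_edges f.
  apply/imsetP => -[_ /cocktail_edgesP[v [v' [vv' ->]]]].
  have -> : s = (place f @: [set (i, true); (i, false)])%SET.
    by rewrite imsetU !imset_set1.
  move=> /(imset_inj (@place_inj f)) /setP sv.
  have := sv v; have := sv v'; rewrite !inE !eqxx orbT /=.
  by move=> /orP[]/eqP v'E /orP[]/eqP vE; move: vv'; rewrite v'E vE eqxx.
have -> : #|cocktail_edges k|.+1 = #|s |: copy_edges f|%SET.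
  by rewrite cardsU1 sC card_copy_edges.
apply/subset_leq_card/fintype.subsetP => t; rewrite !inE => /orP[/eqP ->|->] //.
by rewrite orbC; apply/orP; left; apply/imsetP; exists i.
Qed.

(** The deterministic step: edges between different pairs fill every facet of the clique complex,
    and the absence of a complete star gives [XU]. *)
Lemma copy_octahedral (G : graph n) f :
  edges_of (copy_edges f) \subset G ->
  (forall x, off_base f x -> ~~ (edges_of (star_edges f x) \subset G)) ->
  retracts_onto_sphere R (clique_complex G) k /\
  has_Z_summand (reduced_homology (clique_complex G) k).
Proof.
move=> /fintype.subsetP fG xG; pose w i a := place f (i, a).
have wlt (i j : 'I_k.+1) a b : (i < j)%N -> (w i a < w j b)%N.
  by move=> ij; apply: iota_lt.
have wneq i : w i false != w i true by apply/eqP => /place_inj.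
have Xw e : facet w e \in faces (clique_complex G).
  rewrite inE; apply/forallP => ed; apply/implyP => /fintype.subsetP ede.
  apply: fG; rewrite inE; have /cards2P[x [y [xy edE]]] := valP ed.
  move: ede; rewrite edE => ede.
  have /imsetP[i _ xi] : x \in facet w e by apply: ede; rewrite !inE eqxx.
  have /imsetP[j _ yj] : y \in facet w e by apply: ede; rewrite !inE eqxx orbT.
  apply/imsetP; exists [set (i, e i); (j, e j)]%SET.
    apply/cocktail_edgesP; exists (i, e i), (j, e j); split=> //=.
    by apply/eqP => ij; move: xy; rewrite xi yj ij eqxx.
  by rewrite xi yj imsetU !imset_set1.
have XU x : (forall i, [set x; w i false]%SET \in faces (clique_complex G)) ->
    exists i, x = w i false.
  move=> xw; case: (boolP (off_base f x)) => [/xG/negP[]|]; last first.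
    by rewrite negb_forall => /existsP[i /negPn/eqP xi]; exists i.
  apply/fintype.subsetP => ed; rewrite inE => /imsetP[i _ edi].
  have := xw i; rewrite inE => /forallP/(_ ed)/implyP; apply.
  by rewrite edi.
split; first exact: (crosspolytope_retract R wlt wneq Xw XU).
exact: (crosspolytope_homology wlt wneq Xw XU).
Qed.

Hypothesis p01 : 0 < p <= 1.
Hypothesis m0 : (0 < m)%N.

Let p0 : 0 < p. Proof. by case/andP: p01. Qed.
Let p1 : p <= 1. Proof. by case/andP: p01. Qed.
Let p01' : 0 <= p <= 1. Proof. by rewrite ltW. Qed.

Local Notation mu := ((m%:R : R) ^+ (k.+1 * 2) * p ^+ #|cocktail_edges k|).

Definition num_copies (G : graph n) : R :=
  \sum_(f : {ffun V -> 'I_m}) (edges_of (copy_edges f) \subset G)%:R.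

Definition num_coned_copies (G : graph n) : R :=
  \sum_(f : {ffun V -> 'I_m}) \sum_(x | off_base f x)
    (edges_of (copy_edges f :|: star_edges f x)%SET \subset G)%:R.

Lemma card_placements : (#|{ffun V -> 'I_m}|%:R : R) = m%:R ^+ (k.+1 * 2).
Proof. by rewrite card_ffun card_prod !card_ord card_bool natrX. Qed.

Lemma mean_num_copies : \sum_G gnp_weight p G * num_copies G = mu.
Proof.
under eq_bigr do rewrite mulr_sumr.
rewrite exchange_big /=.
under eq_bigr => f _.
  rewrite (sum_gnp_weight_sub p) card_edges_of; last exact: card_copy_edge.
  rewrite card_copy_edges; over.
by rewrite sumr_const -[LHS]mulr_natl card_placements.
Qed.

(** Given a copy, each of its k+1 antipodes v_i costs at least one more edge, and a vertex off the
    copy costs k+1 more. *)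
Lemma mean_num_coned_copies :
  \sum_G gnp_weight p G * num_coned_copies G <=
  mu * (k.+1%:R * p + n%:R * p ^+ k.+1).
Proof.
under eq_bigr do rewrite mulr_sumr.
rewrite exchange_big /=.
apply: (@le_trans _ _ (\sum_(f : {ffun V -> 'I_m})
    p ^+ #|cocktail_edges k| * (k.+1%:R * p + n%:R * p ^+ k.+1))); last first.
  by rewrite sumr_const -[_ *+ _]mulr_natl card_placements mulrA.
apply: ler_sum => f _.
under eq_bigr do rewrite mulr_sumr.
rewrite exchange_big /=.
pose anti x := [exists i, x == place f (i, true)].
apply: (@le_trans _ _ (\sum_x p ^+ #|cocktail_edges k| *
    ((anti x)%:R * p + p ^+ k.+1))).
  rewrite big_mkcond /=; apply: ler_sum => x _; case: ifP => [xf|_]; last first.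
    by rewrite mulr_ge0 ?exprn_ge0 ?addr_ge0 ?mulr_ge0 ?exprn_ge0 // ltW.
  rewrite sum_gnp_weight_sub card_edges_of; last first.
    by move=> s; rewrite inE => /orP[/card_copy_edge|/(card_star_edge xf)].
  rewrite /anti; case: existsP => [[i /eqP ->]|nx].
    rewrite mul1r mulrDr -exprSr ler_wpDr ?mulr_ge0 ?exprn_ge0 ?(ltW p0) //.
    by rewrite ler_wiXn2l ?(ltW p0) // card_star_edges_antipode.
  rewrite mul0r add0r -exprD card_star_edges // => -[i []].
    by apply/eqP => xi; apply: nx; exists i; apply/eqP.
  exact: (forallP xf).
rewrite -mulr_sumr ler_wpM2l ?exprn_ge0 ?(ltW p0) // big_split /=.
rewrite -mulr_suml sumr_const card_ord -[_ *+ n]mulr_natl lerD2r ler_wpM2r ?(ltW p0) //.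
rewrite -natr_sum ler_nat -big_mkcond /= sum1_card.
rewrite -[leqRHS](card_ord k.+1).
apply: leq_trans (leq_imset_card (fun i => place f (i, true)) _).
apply/subset_leq_card/fintype.subsetP => x /existsP[i /eqP ->].
by apply/imsetP; exists i.
Qed.

(** Two placements agreeing on s roles contribute at most p^(2e) q^s with q = p^(-k), and m + q = m
    (1 + 1/(p^k m)). *)
Lemma second_moment_num_copies :
  \sum_G gnp_weight p G * num_copies G ^+ 2 <=
  mu ^+ 2 * (1 + (p ^+ k * m%:R)^-1) ^+ (k.+1 * 2).
Proof.
have mR : 0 < (m%:R : R) by rewrite ltr0n.
set e := #|cocktail_edges k|; set q := (p ^+ k)^-1.
have q0 : 0 < q by rewrite invr_gt0 exprn_gt0.
have -> : \sum_G gnp_weight p G * num_copies G ^+ 2 =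
    \sum_(f : {ffun V -> 'I_m}) \sum_(f' : {ffun V -> 'I_m})
      p ^+ #|edges_of (copy_edges f :|: copy_edges f')%SET|.
  transitivity (\sum_(G : graph n) \sum_(f : {ffun V -> 'I_m}) \sum_(f' : {ffun V -> 'I_m})
      gnp_weight p G * (edges_of (copy_edges f :|: copy_edges f')%SET \subset G)%:R).
    apply: eq_bigr => G _; rewrite expr2 /num_copies big_distrlr mulr_sumr.
    apply: eq_bigr => f _; rewrite mulr_sumr; apply: eq_bigr => f' _.
    by rewrite edges_ofU finset.subUset -mulnb natrM.
  rewrite exchange_big; apply: eq_bigr => f _; rewrite exchange_big.
  by apply: eq_bigr => f' _; rewrite sum_gnp_weight_sub.
(* Roles are placed independently, so the sum factors; each factor is (m - 1) + q, bounded by m +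
   q. *)
have qm f : \sum_(f' : {ffun V -> 'I_m}) q ^+ #|[set v | f v == f' v]%SET| <=
    (m%:R + q) ^+ (k.+1 * 2).
  have -> : \sum_(f' : {ffun V -> 'I_m}) q ^+ #|[set v | f v == f' v]%SET| =
      \sum_(f' : {ffun V -> 'I_m}) \prod_v (if f v == f' v then q else 1).
    apply: eq_bigr => f' _; rewrite -prodr_const big_mkcond /=.
    by apply: eq_bigr => v _; rewrite inE.
  rewrite -(bigA_distr_bigA (fun v a => if f v == a then q else 1)).
  have -> : (k.+1 * 2)%N = #|{: V}| by rewrite card_prod card_ord card_bool.
  rewrite -prodr_const; apply: ler_prod => v _; apply/andP; split.
    by apply: sumr_ge0 => a _; case: ifP => // _; apply: ltW.
  rewrite (bigD1 (f v)) //= eqxx addrC lerD2r.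
  apply: (@le_trans _ _ (\sum_(a < m) 1)); last by rewrite sumr_const card_ord.
  rewrite [leRHS](bigD1 (f v)) //= ler_wpDl //; apply: ler_sum => a.
  by rewrite eq_sym => /negbTE ->.
have -> : mu ^+ 2 * (1 + (p ^+ k * m%:R)^-1) ^+ (k.+1 * 2) =
    \sum_(f : {ffun V -> 'I_m}) p ^+ (2 * e) * (m%:R + q) ^+ (k.+1 * 2).
  rewrite sumr_const -[RHS]mulr_natl card_placements.
  have -> : m%:R + q = m%:R * (1 + (p ^+ k * m%:R)^-1).
    by rewrite mulrDr mulr1 invfM mulrCA mulfV ?mulr1 // gt_eqF.
  have alg (a b c : R) : (a * b) ^+ 2 * c = a * (b ^+ 2 * (a * c)) by ring.
  by rewrite (mulnC 2%N) (exprM p e 2) [in RHS]exprMn -alg.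
apply: ler_sum => f _; apply: le_trans (ler_wpM2l _ (qm f)); last first.
  by rewrite exprn_ge0 // ltW.
rewrite mulr_sumr; apply: ler_sum => f' _.
rewrite card_edges_of; last first.
  by move=> s; rewrite inE => /orP[]/card_copy_edge.
rewrite /q exprVn -exprM ler_pdivlMr ?exprn_gt0 // -exprD.
by rewrite ler_wiXn2l ?(ltW p0) // card_copy_edgesU.
Qed.

(** If [A] fails, every copy in [G] has a vertex completing its star, whence [num_copies] is at most
    [num_coned_copies]. *)
Lemma octahedral_prob (A : graph n -> Prop) :
  (forall G, retracts_onto_sphere R (clique_complex G) k /\
     has_Z_summand (reduced_homology (clique_complex G) k) -> A G) ->
  1 - (4 * ((1 + (p ^+ k * m%:R)^-1) ^+ (k.+1 * 2) - 1) +
       2 * (k.+1%:R * p + n%:R * p ^+ k.+1)) <= gnp_prob p A.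
Proof.
move=> GA; apply: (gnp_prob_second_moment (M := num_copies) (B := num_coned_copies)
  p01' _ _ _ mean_num_copies second_moment_num_copies mean_num_coned_copies).
- by rewrite mulr_gt0 ?exprn_gt0 ?ltr0n.
- by move=> G; apply: sumr_ge0 => f _; apply: sumr_ge0.
move=> G nA; apply: ler_sum => f _; case: (boolP (_ \subset G)) => [fG|_]; last first.
  by apply: sumr_ge0.
have [[x [xf xG]]|nx] :=
    pselect (exists x, off_base f x /\ edges_of (star_edges f x) \subset G).
  rewrite (bigD1 x) //= edges_ofU finset.subUset fG xG /= lerDl.
  by apply: sumr_ge0.
case: nA; apply: GA; apply: (copy_octahedral fG) => x xf.
by apply/negP => xG; apply: nx; exists x.
Qed.
End OctahedralCopies.

(** * Choice of the blocks and passage to the limit *)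

(** Block 2i + b consists of m consecutive vertices; division by m recovers the block, and parity
    recovers b. *)
Lemma ordered_blocks k n m : (k.+1 * 2 * m <= n)%N ->
  exists iota : 'I_k.+1 * bool -> 'I_m -> 'I_n,
    (forall v v' a a', iota v a = iota v' a' -> v = v' /\ a = a') /\
    (forall (v v' : 'I_k.+1 * bool) a a', (v.1 < v'.1)%N -> (iota v a < iota v' a')%N).
Proof.
move=> mn; pose pos (v : 'I_k.+1 * bool) (a : 'I_m) := ((v.1 * 2 + v.2) * m + a)%N.
have pos_lt v a : (pos v a < n)%N.
  apply: leq_trans mn; case: v => i b; rewrite /pos /=.
  have := ltn_ord i; have := ltn_ord a; case: b => /=; nia.
exists (fun v a => Ordinal (pos_lt v a)); split=> [v v' a a'|v v' a a' /= vv'].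
  move=> /(congr1 val) /= pv.
  have am : (a < m)%N := ltn_ord a; have a'm : (a' < m)%N := ltn_ord a'.
  have m0 : (0 < m)%N by apply: leq_ltn_trans am.
  have blk : (v.1 * 2 + v.2 = v'.1 * 2 + v'.2)%N.
    by have := congr1 (divn^~ m) pv; rewrite !divnMDl // !divn_small // !addn0.
  have aa' : a = a' by apply: val_inj; move: pv; rewrite /pos blk => /addnI.
  split=> //; case: v v' blk {pv} => [i b] [j c] /= ij.
  have bc : b = c by have := congr1 odd ij; rewrite !oddD !oddM !andbF /= !oddb.
  by congr pair => //; apply: val_inj => /=; move: ij; rewrite bc; lia.
case: v v' vv' => [i b] [j c] /= ij; rewrite /pos /=.
by have := ltn_ord a; have := ltn_ord a'; case: b; case: c => /=; nia.
Qed.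

Section Asymptotics.
Variables (R : realType) (k : nat) (p : nat -> R).
Hypothesis hk : (1 <= k)%N.
Hypothesis hp : forall n, 0 <= p n <= 1.
Hypothesis hp0 : (fun n => p n ^+ k.+1 * n%:R) @ \oo --> (0 : R).
Hypothesis hpoo : (fun n => p n ^+ k * n%:R) @ \oo --> +oo.

Lemma almost_always_octahedral (A : forall n, graph n -> Prop) :
  (forall n (G : graph n), retracts_onto_sphere R (clique_complex G) k /\
     has_Z_summand (reduced_homology (clique_complex G) k) -> A n G) ->
  almost_always p A.
Proof.
move=> GA; pose K := (k.+1 * 2)%N.
(* The factor 2K compensates for m = floor(n/K), since n <= 2Km once n >= K. *)
pose x n := (2 * K)%:R * (p n ^+ k * n%:R)^-1.
pose y n := p n ^+ k.+1 * n%:R.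
pose lower n := 1 - (4 * ((1 + x n) ^+ K - 1) + 2 * (k.+1%:R * y n + y n)).
have x0 : x @ \oo --> (0 : R).
  rewrite -[X in _ --> X](mulr0 (2 * K)%:R); apply: cvgM; first exact: cvg_cst.
  have pos : \forall n \near \oo, 0 < p n ^+ k * n%:R.
    by move/cvgryPgt: hpoo; exact.
  exact: (gtr0_cvgV0 pos).2.
have lower1 : lower @ \oo --> (1 : R).
  have -> : (1 : R) = 1 - (4 * ((1 + 0) ^+ K - 1) + 2 * (k.+1%:R * 0 + 0)).
    by rewrite addr0 expr1n; ring.
  have cst (c : R) : (fun _ : nat => c) @ \oo --> c by exact: cvg_cst.
  have x1K : (fun n => (1 + x n) ^+ K) @ \oo --> ((1 + 0) ^+ K : R).
    have c1 : (fun n => 1 + x n) @ \oo --> (1 + 0 : R) by apply: cvgD.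
    have c2 := @exprn_continuous R K (1 + 0).
    exact: (cvg_comp _ _ c1 c2).
  apply: cvgB (cst _) _; apply: cvgD; apply: cvgM (cst _) _.
    exact: cvgB.
  by apply: cvgD => //; apply: cvgM.
apply: (squeeze_cvgr _ lower1 (@cvg_cst _ (1 : R) _ _ _)).
near=> n; rewrite gnp_prob_le1 // andbT.
have nK : (K <= n)%N by near: n; exact: nbhs_infty_ge.
have pkn : 1 <= p n ^+ k * n%:R by near: n; move/cvgryPge: hpoo; exact.
have /andP[pn0 pn1] := hp n.
have n0 : 0 < (n%:R : R) by rewrite ltr0n; apply: leq_trans nK; rewrite muln_gt0.
have pk0 : 0 < p n ^+ k by rewrite -(pmulr_lgt0 _ n0); apply: lt_le_trans pkn.
(* Here k >= 1 enters: p = 0 would give p^k = 0. *)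
have pgt0 : 0 < p n.
  rewrite lt_neqAle pn0 andbT eq_sym; apply/negP => /eqP pz.
  by move: pk0; rewrite pz expr0n gtn_eqF // ltxx.
pose m := (n %/ K)%N.
have mpos : (0 < m)%N by rewrite divn_gt0 // muln_gt0.
have Kmn : (k.+1 * 2 * m <= n)%N by rewrite mulnC leq_trunc_div.
have [iota [iota_inj iota_lt]] := ordered_blocks Kmn.
apply: le_trans (octahedral_prob iota_inj iota_lt _ mpos (GA n)); last by rewrite pgt0.
have nKm : (n <= 2 * K * m)%N.
  have := divn_eq n K; have : (n %% K < K)%N by rewrite ltn_mod muln_gt0.
  by rewrite -/m; nia.
have xm : (p n ^+ k * m%:R)^-1 <= x n.
  rewrite /x ler_pdivlMr ?mulr_gt0 // ler_pdivrMl ?mulr_gt0 ?ltr0n //.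
  by rewrite -mulrA ler_pM2l // -natrM ler_nat mulnC.
have py : p n <= y n.
  by rewrite /y exprS -mulrA ler_peMr // ltW.
have xm0 : 0 <= (p n ^+ k * m%:R)^-1 by rewrite invr_ge0 mulr_ge0 // ltW.
rewrite /lower lerD2l lerN2; apply: lerD; rewrite ler_pM2l //.
  rewrite lerD2r lerXn2r ?nnegrE ?lerD2l ?addr_ge0 //.
  exact: le_trans xm0 xm.
by apply: lerD; rewrite ?ler_wpM2l // /y mulrC.
Unshelve. all: by end_near. Qed.
End Asymptotics.

Theorem theorem3p5 (R : realType) (k : nat) (p : nat -> R)
    (hk : (1 <= k)%N)
    (hp : forall n, 0 <= p n <= 1)
    (hp0 : (fun n => p n ^+ k.+1 * n%:R) @ \oo --> (0 : R))
    (hpoo : (fun n => p n ^+ k * n%:R) @ \oo --> +oo) :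
  almost_always p (fun n G => retracts_onto_sphere R (clique_complex G) k) /\
  almost_always p
    (fun n G => has_Z_summand (reduced_homology (clique_complex G) k)).
Proof.
split; apply: (almost_always_octahedral hk hp hp0 hpoo) => n G [] //.
Qed.
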